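(* Let $G=(\mathcal R,A_s)$ be a grammar and $w=w_1\cdots w_n\in\mathrm{WORDS}^*$ ($n\ge 0$). If $w\in L(G)$, then the computation triggered by $w$ is successful.
   Context: **Types, features, TFSs.** Fix non-empty finite disjoint sets $\mathrm{FEATS}$, $\mathrm{TYPES}$; $\mathrm{TYPES}$ has a partial order $\sqsubseteq$ in which every subset with an upper bound has a least upper bound (written $\sqcup$), with least element $\bot$ and greatest element $\top$. Fix an infinite set $\mathrm{NODES}$ with a typing function $\theta:\mathrm{NODES}\to\mathrm{TYPES}$ all of whose fibres are infinite. $\mathrm{PATHS}=\mathrm{FEATS}^*$, with empty path $\epsilon$. A typed feature structure (TFS) is $(Q,\bar q,\delta)$ with $Q\subseteq\mathrm{NODES}$ finite non-empty, $\bar q\in Q$, $\delta:Q\times\mathrm{FEATS}\to Q$ partial, every node reachable from $\bar q$; $\delta$ extends to paths. A multi-rooted structure (MRS) is a finite graph $(Q,\delta)$ of this kind with an ordered repetition-free list of roots $\bar q_1,\dots,\bar q_m\in Q$ from which jointly all of $Q$ is reachable; its length is $m$. A TFS is an MRS of length 1. **AMRSs.** A pre-AMRS is $A=\langle Ind,\Pi,\Theta,\approx\rangle$ with $Ind=\{1,\dots,m\}$ ($m\ge0$), $\Pi\subseteq Ind\times\mathrm{PATHS}$ containing some $(i,\pi)$ for each $i\in Ind$, $\Theta:\Pi\to\mathrm{TYPES}$ total, and $\approx$ a relation on $\Pi$. It is an abstract multi-rooted structure (AMRS) of length $len(A)=m$ if: $\Pi$ is prefix-closed ($(i,\pi\alpha)\in\Pi\Rightarrow(i,\pi)\in\Pi$);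 it is fusion-closed (if $(i,\pi\alpha),(i',\pi'\alpha')\in\Pi$ and $(i,\pi)\approx(i',\pi')$ then $(i,\pi\alpha'),(i',\pi'\alpha)\in\Pi$, $(i,\pi\alpha')\approx(i',\pi'\alpha')$ and $(i',\pi'\alpha)\approx(i,\pi\alpha)$); $\approx$ is an equivalence relation with finitely many classes; $\Theta$ is constant on classes. $\lambda$ is the AMRS of length 0. AMRSs of length 1 are identified with abstract feature structures (AFSs). For an MRS $\sigma$ with roots $\bar q_1,\dots,\bar q_m$, $Abs(\sigma)$ is the AMRS with $Ind=\{1,\dots,m\}$, $\Pi=\{(i,\pi)\mid\delta(\bar q_i,\pi)\text{ defined}\}$, $\Theta(i,\pi)=\theta(\delta(\bar q_i,\pi))$, $(i,\pi)\approx(j,\pi')$ iff $\delta(\bar q_i,\pi)=\delta(\bar q_j,\pi')$. $A\sqsubseteq B$ iff $Ind_A=Ind_B$, $\Pi_A\subseteq\Pi_B$, $\approx_A\subseteq\approx_B$, and $\Theta_A(i,\pi)\sqsubseteq\Theta_B(i,\pi)$ on $\Pi_A$. $A^{j\ldots k}$ is the sub-structure of $A$ on indices $j,\dots,k$, renumbered from 1; $A^j=A^{j\ldots j}$. The concatenation $A\cdot B$ juxtaposes $A$ and $B$ (shifting $B$'s indices by $len(A)$) with no $\approx$-pairs between the two parts. **Unification.** For a pre-AMRS: $Cl$ is the least extension to a prefix- and fusion-closed one (added paths get type $\bot$), $Eq$ replaces $\approx$ by the least equivalence relation on $\Pi$ containing it, $Ty$ replaces $\Theta(i,\pi)$ by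 $\bigsqcup_{(i',\pi')\approx(i,\pi)}\Theta(i',\pi')$. For an AMRS $A$, $J\subseteq Ind_A$, and $B$ either an AMRS with $J\subseteq Ind_B$ (put $f(i)=i$) or an AFS with $|J|=1$ (put $f(i)=1$), $(A,J)\sqcup B=Ty(Eq(Cl(C)))$, where $Ind_C=Ind_A$; $\Pi_C=\Pi_A\cup\{(i,\pi)\mid i\in J,(f(i),\pi)\in\Pi_B\}$; $\Theta_C(i,\pi)$ is $\Theta_A(i,\pi)$ if $i\notin J$, and for $i\in J$ it is the join of those of $\Theta_A(i,\pi)$, $\Theta_B(f(i),\pi)$ that are defined; $\approx_C=\approx_A\cup\{((i_1,\pi_1),(i_2,\pi_2))\mid i_1,i_2\in J,(f(i_1),\pi_1)\approx_B(f(i_2),\pi_2)\}$. The unification fails (is $\top$) if some path of the result has type $\top$. Convention: all structures in grammars, derivations and items have no element of type $\top$, and every unification used as an operand or in an equation below is required to be defined and not fail. For AFSs, $A\sqcup B=(A,\{1\})\sqcup B$. **Grammars.** Fix a set $\mathrm{WORDS}$ and a lexicon assigning to each word $u$ a set $Cat(u)$ of TFSs. A rule is an MRS of length $m>0$; its last element is its head, the first $m-1$ elements its body. A grammar $G=(\mathcal R,A_s)$ consists of a finite set $\mathcal R$ of rules and a TFS $A_s$. ($\mathcal R$ may contain rules of length 1, including lexical categories regarded as rules with empty body; no lexical category is the head of a rule of length $>1$.) For $w=w_1\cdots w_n$, $PT_w(j,k)$ is the set of AMRSs $Abs(A_j)\cdot\ldots\cdot Abs(A_k)$ with $A_i\in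 Cat(w_i)$; $PT_w(j,k)=\{\lambda\}$ if $j>k$. **Derivation.** An AMRS $A$ of length $k$ strongly derives $B$, $A\rightarrow B$, iff there are $\rho\in\mathcal R$, an AMRS $R\sqsupseteq Abs(\rho)$ of length $m$, and $j\in Ind_A$ such that: $A=(A,\{j\})\sqcup R^m$ and $R=(R,\{m\})\sqcup A^j$; if $m\ge2$, there is $i$ such that, writing $S=B^{i\ldots i+m-2}$, $S=(S,\{1,\dots,m-1\})\sqcup R^{1\ldots m-1}$ and $R=(R,\{1,\dots,m-1\})\sqcup S$; and $B$ is the replacement of the $j$-th element of $A$ by the body of $R$, i.e. with $f(i)=i$ for $1\le i<j$, $f(i)=i+m-2$ for $j<i\le k$, $g(i)=i+j-1$ for $1\le i<m$, $B=Ty(Eq(Cl(B')))$ where $Ind_{B'}=\{1,\dots,k+m-2\}$; $\Pi_{B'}=\{(f(i),\pi)\mid(i,\pi)\in\Pi_A,i\ne j\}\cup\{(g(i),\pi)\mid(i,\pi)\in\Pi_R,i<m\}$; $\Theta_{B'}(f(i),\pi)=\Theta_A(i,\pi)$, $\Theta_{B'}(g(i),\pi)=\Theta_R(i,\pi)$; and $\approx_{B'}$ consists of the pairs $(f(i_1),\pi_1),(f(i_2),\pi_2)$ with $(i_1,\pi_1)\approx_A(i_2,\pi_2)$, the pairs $(g(i_1),\pi_1),(g(i_2),\pi_2)$ with $(i_1,\pi_1)\approx_R(i_2,\pi_2)$, and, in both orders, the pairs $(f(i_1),\pi_1),(g(i_2),\pi_2)$ for which some $\pi_3$ satisfies $(i_1,\pi_1)\approx_A(j,\pi_3)$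 and $(m,\pi_3)\approx_R(i_2,\pi_2)$. $\stackrel{*}{\rightarrow}$ is the reflexive transitive closure of $\rightarrow$. $A$ derives $B$, $A\leadsto B$, iff there are AMRSs $A',B'$ with $len(A')=len(A)$, $(A,\{1,\dots,len(A)\})\sqcup A'\ne\top$, $B\sqsubseteq B'$ and $A'\stackrel{*}{\rightarrow}B'$. $L(G)=\{w=w_1\cdots w_n\in\mathrm{WORDS}^*\mid Abs(A_s)\leadsto B\text{ for some }B\in PT_w(1,n)\}$. **Computation.** An item is $[i,A,j,c]$ with $i\le j$ in $\mathbb N$, $A$ an AMRS, $c\in\{\mathrm{Act},\mathrm{Comp}\}$. For a set $I$ of items, $x\in T_{G,w}(I)$ iff one of: (1) there are $\rho\in\mathcal R$ of length $m>1$ with $R=Abs(\rho)$, $k<m-1$, $[i_\alpha,A_\alpha,j_\alpha,\mathrm{Act}]\in I$ with $len(A_\alpha)=k$, $[i_\beta,A_\beta,j_\beta,\mathrm{Comp}]\in I$ with $len(A_\beta)=1$, $j_\alpha=i_\beta$, $B=(R,\{1,\dots,k\})\sqcup A_\alpha$, $C=(B,\{k+1\})\sqcup A_\beta$, $x=[i_\alpha,C^{1\ldots k+1},j_\beta,\mathrm{Act}]$; (2) there are $\rho\in\mathcal R$ of length $m>1$ with $R=Abs(\rho)$ and $[i_\alpha,A_\alpha,j_\alpha,\mathrm{Act}]\in I$ with $len(A_\alpha)=m-1$, $C=(R,\{1,\dots,m-1\})\sqcup A_\alpha$, $x=[i_\alpha,C^m,j_\alpha,\mathrm{Comp}]$;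 (3) $x=[i,\lambda,i,\mathrm{Act}]$ for some $0\le i\le n$; (4) $x=[i,Abs(\rho),i,\mathrm{Comp}]$ for some $0\le i\le n$ and $\rho\in\mathcal R$ of length 1; (5) $x=[i-1,Abs(A_i),i,\mathrm{Comp}]$ for some $0<i\le n$, $A_i\in Cat(w_i)$. The computation triggered by $w$ is the sequence $I_0=\emptyset$, $I_{l+1}=T_{G,w}(I_l)$. It is successful if for some $l$ there is $[0,A,n,\mathrm{Comp}]\in I_l$ with $len(A)=1$ and $A\sqcup Abs(A_s)\ne\top$. *)

(* Defs.v *)
From Stdlib Require Import Relation_Operators.
From mathcomp Require Import all_boot all_order finmap.
From mathcomp Require Import boolp classical_sets cardinality.
From mathcomp Require Import zify.

Set Implicit Arguments.
Unset Strict Implicit.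
Unset Printing Implicit Defensive.

Local Open Scope classical_set_scope.

Section PreAMRS.

Context {d : Order.disp_t} {FEATS : finType} {TYPES : finTBPOrderType d}.

(* (i, pi) with i a root index and pi a path. Indices start at 1. *)
Definition ipath := (nat * seq FEATS)%type.

Definition Ind (m : nat) : pred nat := [pred i | 1 <= i <= m].

(* The value of [typ] outside [paths] is meaningless: it is ignored by [same]
   and [pre_le] below and by all the operations. *)
Record preAMRS := PreAMRS {
  len : nat;
  paths : set ipath;
  typ : ipath -> TYPES;
  eqv : ipath -> ipath -> Prop
}.

Implicit Types (A B C R : preAMRS) (P : set ipath) (E : ipath -> ipath -> Prop).

(* Equality of pre-AMRSs, as tuples of sets and functions. *)
Definition same A B : Prop :=
  [/\ len A = len B,
      forall x, paths A x <-> paths B x,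
      forall x, paths A x -> typ A x = typ B x &
      forall x y, eqv A x y <-> eqv B x y].

Definition pre_le A B : Prop :=
  [/\ len A = len B,
      paths A `<=` paths B,
      forall x y, eqv A x y -> eqv B x y &
      forall x, paths A x -> (typ A x <= typ B x)%O].

Definition prefix_closed P : Prop :=
  forall i p a, P (i, p ++ a) -> P (i, p).

Definition fusion_closed P E : Prop :=
  forall i p a i' p' a', P (i, p ++ a) -> P (i', p' ++ a') ->
    E (i, p) (i', p') ->
    [/\ P (i, p ++ a'), P (i', p' ++ a),
        E (i, p ++ a') (i', p' ++ a') & E (i', p' ++ a) (i, p ++ a)].

Record is_preAMRS A : Prop := {
  paths_ind : forall x, paths A x -> x.1 \in Ind (len A);
  paths_root : forall i, i \in Ind (len A) -> exists p, paths A (i, p);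
  eqv_paths : forall x y, eqv A x y -> paths A x /\ paths A y
}.

Record is_AMRS A : Prop := {
  AMRS_pre : is_preAMRS A;
  AMRS_prefix : prefix_closed (paths A);
  AMRS_fusion : fusion_closed (paths A) (eqv A);
  AMRS_refl : forall x, paths A x -> eqv A x x;
  AMRS_sym : forall x y, eqv A x y -> eqv A y x;
  AMRS_trans : forall x y z, eqv A x y -> eqv A y z -> eqv A x z;
  AMRS_finite : finite_set [set [set y | eqv A x y] | x in paths A];
  AMRS_typ : forall x y, eqv A x y -> typ A x = typ A y
}.

Definition consistent A : Prop := forall x, paths A x -> typ A x <> \top%O.

(* The AMRSs that may occur in derivations and items: no path of type \top. *)
Record amrs := Amrs {
  amrs_pre :> preAMRS;
  amrsP : is_AMRS amrs_pre;
  amrs_consistent : consistent amrs_pre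
}.

Definition lambda : preAMRS :=
  PreAMRS 0 set0 (fun=> \bot%O) (fun _ _ => False).

(* Indices j, ..., k of A, renumbered from 1. *)
Definition sub A (j k : nat) : preAMRS :=
  let up (x : ipath) : ipath := (x.1 + j - 1, x.2) in
  PreAMRS (k.+1 - j)
    [set x | x.1 \in Ind (k.+1 - j) /\ paths A (up x)]
    (fun x => typ A (up x))
    (fun x y => [/\ x.1 \in Ind (k.+1 - j), y.1 \in Ind (k.+1 - j) &
                    eqv A (up x) (up y)]).

Definition elt A (j : nat) : preAMRS := sub A j j.

Definition concat A B : preAMRS :=
  let low (x : ipath) := x.1 <= len A in
  let down (x : ipath) : ipath := (x.1 - len A, x.2) in
  PreAMRS (len A + len B)
    [set x | if low x then paths A x else paths B (down x)]
    (fun x => if low x then typ A x else typ B (down x))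
    (fun x y => if low x then low y /\ eqv A x y
                else ~~ low y /\ eqv B (down x) (down y)).

(* Least upper bound of a set of types. The default \bot of [supremum] is the
   right value on the empty set; on other sets the default is irrelevant when
   all bounded sets have least upper bounds, since \top bounds everything. *)
Definition lub (S : set TYPES) : TYPES := supremum \bot%O S.

(* Least prefix- and fusion-closed extension, as the intersection of all such
   extensions. *)
Definition closed_ext A P E : Prop :=
  [/\ paths A `<=` P, (forall x y, eqv A x y -> E x y),
      prefix_closed P & fusion_closed P E].

Definition Cl A : preAMRS :=
  PreAMRS (len A)
    [set x | forall P E, closed_ext A P E -> P x]
    (fun x => if `[< paths A x >] then typ A x else \bot%O)
    (fun x y => forall P E, closed_ext A P E -> E x y).

(* Equivalence relation on [paths A] generated by [eqv A]. *)
Inductive eq_closure A : ipath -> ipath -> Prop :=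
| EqBase x y : eqv A x y -> eq_closure A x y
| EqRefl x : paths A x -> eq_closure A x x
| EqSym x y : eq_closure A x y -> eq_closure A y x
| EqTrans x y z : eq_closure A x y -> eq_closure A y z -> eq_closure A x z.

Definition Eq A : preAMRS := PreAMRS (len A) (paths A) (typ A) (eq_closure A).

Definition Ty A : preAMRS :=
  PreAMRS (len A) (paths A)
    (fun x => lub [set typ A y | y in [set y | eqv A y x]]) (eqv A).

(* The pre-AMRS C from which (A, J) |_| B is obtained; f sends the indices of A
   lying in J to indices of B. *)
Definition unif_base A (J : pred nat) (f : nat -> nat) B : preAMRS :=
  let to (x : ipath) : ipath := (f x.1, x.2) in
  PreAMRS (len A)
    [set x | paths A x \/ (x.1 \in J /\ paths B (to x))]
    (fun x => if x.1 \in J then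
        lub [set t | (paths A x /\ t = typ A x) \/
                     (paths B (to x) /\ t = typ B (to x))]
      else typ A x)
    (fun x y => eqv A x y \/
                [/\ x.1 \in J, y.1 \in J & eqv B (to x) (to y)]).

Definition unif_along A J f B : preAMRS := Ty (Eq (Cl (unif_base A J f B))).

(* (A, J) |_| B where J is a set of indices of both A and B. *)
Definition unif A (J : pred nat) B : preAMRS := unif_along A J id B.

(* (A, {j}) |_| B where B has length 1. *)
Definition unif1 A (j : nat) B : preAMRS := unif_along A (pred1 j) (fun=> 1) B.

(* Replacement of the j-th element of A by the body of R: [repl_f] and [repl_g]
   give the new positions of the remaining elements of A and of the elements of
   the body of R. *)
Definition repl_f R (j i : nat) : nat := if i < j then i else i + len R - 2.
Definition repl_g (j i : nat) : nat := i + j - 1.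

Inductive repl_paths A R (j : nat) : ipath -> Prop :=
| ReplPathA i p : i != j -> paths A (i, p) ->
    repl_paths A R j (repl_f R j i, p)
| ReplPathR i p : i < len R -> paths R (i, p) ->
    repl_paths A R j (repl_g j i, p).

(* The three cases are the inverses of [repl_f] below j, of [repl_g], and of
   [repl_f] above j; see [repl_typ_f] and [repl_typ_g]. *)
Definition repl_typ A R (j : nat) (x : ipath) : TYPES :=
  if x.1 < j then typ A x
  else if x.1 < j + len R - 1 then typ R (x.1 + 1 - j, x.2)
  else typ A (x.1 + 2 - len R, x.2).

Inductive repl_eqv A R (j : nat) : ipath -> ipath -> Prop :=
| ReplEqvA i1 p1 i2 p2 : i1 != j -> i2 != j -> eqv A (i1, p1) (i2, p2) ->
    repl_eqv A R j (repl_f R j i1, p1) (repl_f R j i2, p2)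
| ReplEqvR i1 p1 i2 p2 : i1 < len R -> i2 < len R ->
    eqv R (i1, p1) (i2, p2) ->
    repl_eqv A R j (repl_g j i1, p1) (repl_g j i2, p2)
| ReplEqvAR i1 p1 i2 p2 p3 : i1 != j -> i2 < len R ->
    eqv A (i1, p1) (j, p3) -> eqv R (len R, p3) (i2, p2) ->
    repl_eqv A R j (repl_f R j i1, p1) (repl_g j i2, p2)
| ReplEqvRA i1 p1 i2 p2 p3 : i1 != j -> i2 < len R ->
    eqv A (i1, p1) (j, p3) -> eqv R (len R, p3) (i2, p2) ->
    repl_eqv A R j (repl_g j i2, p2) (repl_f R j i1, p1).

Definition repl_base A R (j : nat) : preAMRS :=
  PreAMRS (len A + len R - 2) (repl_paths A R j) (repl_typ A R j)
    (repl_eqv A R j).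

Definition repl A R (j : nat) : preAMRS := Ty (Eq (Cl (repl_base A R j))).

Lemma repl_typ_f A R j i p : 0 < len R -> 0 < j -> i != j ->
  repl_typ A R j (repl_f R j i, p) = typ A (i, p).
Proof.
move=> R0 j0 /eqP ij; rewrite /repl_typ /repl_f /=.
case: (ltnP i j) => [-> //|ji].
have -> : (i + len R - 2 < j) = false by lia.
have -> : (i + len R - 2 < j + len R - 1) = false by lia.
by congr (typ A (_, p)); lia.
Qed.

Lemma repl_typ_g A R j i p : 0 < i < len R -> 0 < j ->
  repl_typ A R j (repl_g j i, p) = typ R (i, p).
Proof.
move=> iR j0; rewrite /repl_typ /repl_g /=.
have -> : (i + j - 1 < j) = false by lia.
have -> : i + j - 1 < j + len R - 1 by lia.
by congr (typ R (_, p)); lia.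
Qed.

End PreAMRS.

Arguments preAMRS {d} FEATS TYPES.
Arguments amrs {d} FEATS TYPES.

Section Structures.

Context (NODES : choiceType) (FEATS : finType).

Fixpoint walk (delta : NODES -> FEATS -> option NODES) (q : NODES)
    (p : seq FEATS) : option NODES :=
  if p is f :: p' then obind (fun q' => walk delta q' p') (delta q f)
  else Some q.

(* A partial function on Q x FEATS is a total one with values in [option],
   equal to None outside Q. *)
Record mrs := Mrs {
  nodes : {fset NODES};
  delta : NODES -> FEATS -> option NODES;
  roots : seq NODES;
  delta_nodes : forall q f q',
    delta q f = Some q' -> q \in nodes /\ q' \in nodes;
  roots_uniq : uniq roots;
  roots_nodes : forall q, q \in roots -> q \in nodes;
  nodes_reachable : forall q, q \in nodes ->
    exists r p, r \in roots /\ walk delta r p = Some q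
}.

Record tfs := Tfs { tfs_mrs :> mrs; tfs_root : size (roots tfs_mrs) = 1 }.

(* The node delta(q_i, p), with roots q_1, ..., q_m numbered from 1. *)
Definition node_at (s : mrs) (x : nat * seq FEATS) : option NODES :=
  if x.1 is k.+1 then
    obind (fun q => walk (delta s) q x.2) (onth (roots s) k)
  else None.

Context {d : Order.disp_t} {TYPES : finTBPOrderType d}.

Definition Abs (theta : NODES -> TYPES) (s : mrs) : preAMRS FEATS TYPES :=
  PreAMRS (size (roots s))
    [set x | node_at s x]
    (fun x => if node_at s x is Some q then theta q else \bot%O)
    (fun x y => exists2 q, node_at s x = Some q & node_at s y = Some q).

Definition mrs_consistent (theta : NODES -> TYPES) (s : mrs) : Prop :=
  forall q, q \in nodes s -> theta q <> \top%O.

End Structures.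

Section Grammars.

Context {d : Order.disp_t} {FEATS : finType} {TYPES : finTBPOrderType d}
  {NODES : choiceType} (theta : NODES -> TYPES) {WORDS : Type}.

Local Notation Abs := (Abs theta).

Record lexicon := Lexicon {
  Cat :> WORDS -> set (tfs NODES FEATS);
  Cat_consistent : forall u F, Cat u F -> mrs_consistent theta F
}.

(* TFSs are compared through their abstractions, hence up to renaming of
   nodes, in the condition that lexical categories are not heads. *)
Record grammar (L : lexicon) := Grammar {
  rules : set (mrs NODES FEATS);
  start : tfs NODES FEATS;
  rules_finite : finite_set rules;
  rules_nonempty : forall rho, rules rho -> 0 < size (roots rho);
  rules_consistent : forall rho, rules rho -> mrs_consistent theta rho;
  start_consistent : mrs_consistent theta start;
  rules_head : forall rho u F, rules rho -> 1 < size (roots rho) -> L u F ->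
    ~ same (Abs F) (elt (Abs rho) (size (roots rho)))
}.

Context {L : lexicon} (G : grammar L).

Fixpoint PT_seq (w : seq WORDS) : set (preAMRS FEATS TYPES) :=
  if w is u :: w' then
    [set A | exists F B, [/\ L u F, PT_seq w' B & A = concat (Abs F) B]]
  else [set lambda].

Definition PT (w : seq WORDS) (j k : nat) : set (preAMRS FEATS TYPES) :=
  PT_seq (drop (j - 1) (take k w)).

Definition sderiv (A B : amrs FEATS TYPES) : Prop :=
  exists rho (R : amrs FEATS TYPES) (j : nat), let m := len R in
    [/\ rules G rho, pre_le (Abs rho) R, j \in Ind (len A) &
    [/\ same A (unif1 A j (elt R m)),
        same R (unif1 R m (elt A j)),
        2 <= m -> exists i,
          let S := sub B i (i + m - 2) in
          [/\ 1 <= i, i + m - 2 <= len B,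
              same S (unif S (Ind (m - 1)) (sub R 1 (m - 1))) &
              same R (unif R (Ind (m - 1)) S)] &
        same B (repl A R j)]].

Definition derives (A B : preAMRS FEATS TYPES) : Prop :=
  exists A' B' : amrs FEATS TYPES,
    [/\ len A' = len A, consistent (unif A (Ind (len A)) A'),
        pre_le B B' & clos_refl_trans _ sderiv A' B'].

Definition language : set (seq WORDS) :=
  [set w | exists2 B, PT w 1 (size w) B & derives (Abs (start G)) B].

Inductive status := Act | Comp.

Record item := Item {
  item_from : nat;
  item_str : amrs FEATS TYPES;
  item_to : nat;
  item_status : status;
  item_le : item_from <= item_to
}.

Definition item_is (x : item) (i : nat) (A : preAMRS FEATS TYPES) (j : nat)
    (c : status) : Prop :=
  [/\ item_from x = i, same (item_str x) A, item_to x = j &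
      item_status x = c].

Implicit Types (I : set item) (w : seq WORDS) (x : item).

Definition T_combine I x : Prop :=
  exists rho k xa xb, let R := Abs rho in let m := len R in
    let B := unif R (Ind k) (item_str xa) in
    let C := unif1 B k.+1 (item_str xb) in
    [/\ rules G rho, 1 < m, k < m - 1 &
    [/\ I xa, item_status xa = Act & len (item_str xa) = k] /\
    [/\ I xb, item_status xb = Comp & len (item_str xb) = 1] /\
    [/\ item_to xa = item_from xb, consistent B, consistent C &
        item_is x (item_from xa) (sub C 1 k.+1) (item_to xb) Act]].

Definition T_complete I x : Prop :=
  exists rho xa, let R := Abs rho in let m := len R in
    let C := unif R (Ind (m - 1)) (item_str xa) in
    [/\ rules G rho, 1 < m,
        [/\ I xa, item_status xa = Act & len (item_str xa) = m - 1],
        consistent C &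
        item_is x (item_from xa) (elt C m) (item_to xa) Comp].

Definition T_empty w x : Prop :=
  exists2 i, i <= size w & item_is x i lambda i Act.

Definition T_epsilon w x : Prop :=
  exists i rho, [/\ i <= size w, rules G rho, size (roots rho) = 1 &
                    item_is x i (Abs rho) i Comp].

Definition T_lexical w x : Prop :=
  exists i u F, [/\ 0 < i <= size w, onth w (i - 1) = Some u, L u F &
                    item_is x (i - 1) (Abs F) i Comp].

Definition T_step w I : set item :=
  [set x | T_combine I x \/ T_complete I x \/ T_empty w x \/
           T_epsilon w x \/ T_lexical w x].

Definition computation w (l : nat) : set item := iter l (T_step w) set0.

Definition successful w : Prop :=
  exists l x, let A := item_str x in
    [/\ computation w l x, item_from x = 0, item_to x = size w,
        item_status x = Comp &
        len A = 1 /\ consistent (unif A (Ind 1) (Abs (start G)))].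

End Grammars.

(* Main.v *)
(* Induction backwards along the derivation: if complete items that tile [w] lie
   below the elements of [B], and [A] derives [B] in one step with the rule
   instance [R], then the same holds for [A]. The head of [R] and the rewritten
   element of [A] coincide, so gluing [A] and [R] along them gives a structure
   that is already closed, and [B] restricts to the elements of [A] and [R]. The
   items below the body of [R] combine into active items, which stay below [R]
   because unification is a least upper bound; completing the last one gives an
   item below the rewritten element. *)
Require Import Defs.
From mathcomp Require Import all_boot all_order finmap.
From mathcomp Require Import boolp classical_sets cardinality.
From mathcomp Require Import zify.

Set Implicit Arguments.
Unset Strict Implicit.
Unset Printing Implicit Defensive.

Import Order.TTheory.

Local Open Scope classical_set_scope.

(** * Closed structures, and the orders in which structures are compared *)

Section Structures.

Context {d : Order.disp_t} {FEATS : finType} {TYPES : finTBPOrderType d}.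

Local Notation preAMRS := (preAMRS FEATS TYPES).
Local Notation ipath := (ipath (FEATS := FEATS)).

Implicit Types (A B C R U X Y : preAMRS) (x y z : ipath) (J : pred nat).

Definition extend x (a : seq FEATS) : ipath := (x.1, x.2 ++ a).

(** The conditions of [is_AMRS] that mention neither the index set nor the number of classes.
    Closure produces such structures, and its minimality is tested against them. *)
Record closed A : Prop := {
  closed_eqv_paths : forall x y, eqv A x y -> paths A x /\ paths A y;
  closed_prefix : prefix_closed (paths A);
  closed_fusion : fusion_closed (paths A) (eqv A);
  closed_refl : forall x, paths A x -> eqv A x x;
  closed_sym : forall x y, eqv A x y -> eqv A y x;
  closed_trans : forall x y z, eqv A x y -> eqv A y z -> eqv A x z;
  closed_typ : forall x y, eqv A x y -> typ A x = typ A y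
}.

Lemma AMRS_closed A : is_AMRS A -> closed A.
Proof. by case=> [[_ _ ?] ? ? ? ? ? _ ?]; split. Qed.

(** Fusion with an empty continuation on one side makes [eqv] a right congruence for path
    extension. *)
Lemma fusion_extend A : closed A -> forall x y a, eqv A x y ->
  paths A (extend x a) -> paths A (extend y a) /\
  eqv A (extend x a) (extend y a).
Proof.
move=> cA [i p] [i' p'] a xy Pxa; have [_ Py] := closed_eqv_paths cA xy.
rewrite -[p']cats0 in Py.
have [_ ? _ /(closed_sym cA) ?] := closed_fusion cA Pxa Py xy.
by split.
Qed.

Lemma same_refl A : same A A.
Proof. by split. Qed.

Lemma same_pre_le A B : same A B -> pre_le A B.
Proof.
by case=> ? P T E; split=> // [x /P //|x y /E //|x /T ->].
Qed.

Lemma same_sym A B : same A B -> same B A.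
Proof. by case=> ? P T E; split=> // [x|x /P /T|x y]; rewrite ?P ?E. Qed.

Lemma pre_le_trans A B C : pre_le A B -> pre_le B C -> pre_le A C.
Proof.
case=> [l1 P1 E1 T1] [l2 P2 E2 T2]; split.
- by rewrite l1.
- exact: subset_trans P1 P2.
- by move=> x y /E1 /E2.
- by move=> x Ax; apply: le_trans (T1 _ Ax) (T2 _ (P1 _ Ax)).
Qed.

(** Only [\top] lies above [\top]. This is how unifications in the chart are seen not to fail: each
    stays below a consistent structure. *)
Lemma pre_le_consistent A B : pre_le A B -> consistent B -> consistent A.
Proof.
move=> [_ P _ T] cB x Ax tx; apply: (cB x (P _ Ax)).
by apply: le_anti; rewrite lex1 -{1}tx T.
Qed.

(* The order matching [unif_along]: [unif_along A J f B] is the least closed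
   structure above [A] and, in this sense, above [B]. *)
Definition le_along J (f : nat -> nat) B A : Prop :=
  let to x : ipath := (f x.1, x.2) in
  [/\ forall x, x.1 \in J -> paths B (to x) -> paths A x,
      forall x y, x.1 \in J -> y.1 \in J -> eqv B (to x) (to y) -> eqv A x y &
      forall x, x.1 \in J -> paths B (to x) -> (typ B (to x) <= typ A x)%O].

Lemma le_along_trans J f X A B :
  le_along J f X A -> pre_le A B -> le_along J f X B.
Proof.
case=> [P1 E1 T1] [_ P2 E2 T2];
  split=> [x jx /(P1 _ jx)/P2 //|x y jx jy|x jx px].
  by move=> /(E1 _ _ jx jy)/E2.
exact: le_trans (T1 _ jx px) (T2 _ (P1 _ jx px)).
Qed.

Lemma pre_le_along J f X Y A :
  pre_le X Y -> le_along J f Y A -> le_along J f X A.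
Proof.
case=> [_ P1 E1 T1] [P2 E2 T2];
  split=> [x jx /P1/(P2 _ jx) //|x y jx jy|x jx px].
  by move=> /E1/(E2 _ _ jx jy).
exact: le_trans (T1 _ px) (T2 _ jx (P1 _ px)).
Qed.

Definition le_at X A i : Prop := le_along (pred1 i) (fun=> 1) X A.

Lemma le_atP X A i : le_at X A i <->
  [/\ forall p, paths X (1, p) -> paths A (i, p),
      forall p q, eqv X (1, p) (1, q) -> eqv A (i, p) (i, q) &
      forall p, paths X (1, p) -> (typ X (1, p) <= typ A (i, p))%O].
Proof.
split=> [] [P E T]; split.
- by move=> p; apply: (P (i, p)); apply: eqxx.
- by move=> p q; apply: (E (i, p) (i, q)); apply: eqxx.
- by move=> p; apply: (T (i, p)); apply: eqxx.
- by move=> [k p] /eqP /= ->; apply: P.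
- by move=> [k p] [l q] /eqP /= -> /eqP /= ->; apply: E.
- by move=> [k p] /eqP /= ->; apply: T.
Qed.

Lemma pre_le_at A B : pre_le A B -> le_at A B 1.
Proof. by case=> _ P E T; apply/le_atP; split=> [p /P|p q /E|p /T]. Qed.

Lemma le_at_pre_le A B :
  is_AMRS A -> len A = 1 -> len B = 1 -> le_at A B 1 -> pre_le A B.
Proof.
move=> aA lA lB /le_atP[P E T].
have one i p : paths A (i, p) -> i = 1.
  by move/(paths_ind (AMRS_pre aA)); rewrite lA inE /=; lia.
split=> [|[i p] Ap|[i p] [k q] Apq|[i p] Ap]; first by rewrite lA lB.
- by move: (Ap); rewrite (one _ _ Ap) => /P.
- have [/one ip /one kq] := eqv_paths (AMRS_pre aA) Apq.
  by move: Apq; rewrite ip kq => /E.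
- by move: (Ap); rewrite (one _ _ Ap) => /T.
Qed.

Lemma pre_le_Ind A B : pre_le A B -> le_along (Ind (len A)) id A B.
Proof.
by case=> _ P E T; split=> [[i p] _ /P|[i p] [k q] _ _ /E|[i p] _ /T].
Qed.

Lemma Ind_pre_le A B : is_AMRS A -> len A = len B ->
  le_along (Ind (len A)) id A B -> pre_le A B.
Proof.
move=> aA lAB [P E T]; have ind := paths_ind (AMRS_pre aA).
split=> // [[i p] Ap|[i p] [k q] Apq|[i p] Ap].
- exact: P (ind _ Ap) Ap.
- have [/ind ip /ind kq] := eqv_paths (AMRS_pre aA) Apq; exact: E ip kq Apq.
- exact: T (ind _ Ap) Ap.
Qed.

Lemma elt_le_at A i : le_at (elt A i) A i.
Proof.
apply/le_atP; rewrite /elt /sub /=.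
by split=> [p []|p q []|p _]; rewrite add1n subn1.
Qed.

Lemma sub_pre_le A B i j : pre_le A B -> pre_le (sub A i j) (sub B i j).
Proof.
case=> [l P E T]; split=> //= [x [? /P]|x y [? ? /E]|x [_ /T] //].
  by split.
by split.
Qed.

Lemma sub1_le_along A k : le_along (Ind k) id (sub A 1 k) A.
Proof.
by split=> [[i p] _ []|[i p] [j q] _ _ []|[i p] _ []] /=; rewrite ?addnK.
Qed.

(** * Ranges of elements of an AMRS *)

Section Sub.

Variables (A : preAMRS) (j k : nat).
Hypotheses (aA : is_AMRS A) (j0 : 0 < j) (kA : k <= len A).

Let up x : ipath := (x.1 + j - 1, x.2).

Lemma sub_AMRS : is_AMRS (sub A j k).
Proof.
split; first split.
- by move=> x [].
- move=> i ii; have [|p Ap] := paths_root (AMRS_pre aA) (i := i + j - 1).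
    by move: ii; rewrite /= !inE; lia.
  by exists p; split.
- by move=> x y [? ? /(eqv_paths (AMRS_pre aA)) []]; split.
- by move=> i p a [/= ? /(AMRS_prefix aA)]; split.
- move=> i p a i' p' a' [/= Pi Px] [/= Pi' Py] [_ _ E].
  by have [] := AMRS_fusion aA Px Py E; split.
- by move=> x [? /(AMRS_refl aA)].
- by move=> x y [? ? /(AMRS_sym aA)].
- by move=> x y z [? ? xy] [? ? yz]; split=> //; apply: AMRS_trans xy yz.
(* A class of the substructure is the preimage under [up] of a class of [A], cut to the index range,
   so the finitely many classes of [A] yield all of them. *)
- pose g (S : set ipath) :=
    [set y : ipath | y.1 \in Ind (k.+1 - j) /\ S (up y)].
  apply: sub_finite_set (finite_image g (AMRS_finite aA)) => _ [x [xi Ax] <-].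
  exists [set y | eqv A (up x) y]; first by exists (up x).
  by apply/seteqP; split=> y /= => [[]|[]]; split.
- by move=> x y [_ _ /(AMRS_typ aA)].
Qed.

End Sub.

(** * Least upper bounds of types, and the closure of a pre-AMRS *)

Section Closure.

Hypothesis lubs : forall S : set TYPES, has_ubound S -> supremums S !=set0.

Lemma lub_supremums (S : set TYPES) : supremums S (lub S).
Proof.
rewrite /lub /supremum; case: ifPn => [/eqP ->|_].
  by split=> [t []|t _]; apply: le0x.
have /lubs [t St] : has_ubound S.
  by exists \top%O => t _; apply: lex1.
exact: xgetI St.
Qed.

Lemma lub_ge (S : set TYPES) t : S t -> (t <= lub S)%O.
Proof. by move=> St; have [ub _] := lub_supremums S; apply: ub. Qed.

Lemma lub_le (S : set TYPES) t : (forall s, S s -> s <= t)%O -> (lub S <= t)%O.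
Proof. by move=> ub; have [_ lb] := lub_supremums S; apply: lb. Qed.

(** The closure shared by [unif_along] and [repl], which differ only in the base structure fed to
    it. *)
Definition saturation C : preAMRS := Ty (Eq (Cl C)).

Lemma Cl_ext C : closed_ext C (paths (Cl C)) (eqv (Cl C)).
Proof.
split=> [x Cx P E [+ _ _ _]|x y Cxy P E [_ + _ _]||]; rewrite /=.
- exact.
- exact.
- by move=> i p a Px P E PE; have [_ _ pre _] := PE; apply: pre (Px _ _ PE).
move=> i p a i' p' a' Px Px' Exx'; split=> P E PE; have [_ _ _ fus] := PE;
  by have [] := fus _ _ _ _ _ _ (Px _ _ PE) (Px' _ _ PE) (Exx' _ _ PE).
Qed.

(** [U] is one of the closed extensions intersected in [Cl C], its [eqv] absorbs the generated
    equivalence, and the types that [Ty] joins over a class all lie below the one type that [U] has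
    on that class. *)
Lemma saturation_le C U : closed U -> pre_le C U -> pre_le (saturation C) U.
Proof.
move=> cU [l P E T].
have CU : closed_ext C (paths U) (eqv U).
  split=> //; first exact: (closed_prefix cU).
  exact: (closed_fusion cU).
have PU x : paths (Cl C) x -> paths U x by move=> /(_ _ _ CU).
have EU x y : eq_closure (Cl C) x y -> eqv U x y.
  elim=> {x y} [x y|x /PU|x y _|x y z _ xy _ yz].
  - by move=> /(_ _ _ CU).
  - exact: closed_refl.
  - exact: closed_sym.
  - exact: closed_trans xy yz.
split=> // x /PU Ux; apply: lub_le => _ [y /EU yx <-] /=.
(* Paths added by [Cl] have type [\bot]. *)
case: asboolP => [Cy|_]; last exact: le0x.
by rewrite -(closed_typ cU yx); apply: T.
Qed.

Lemma saturation_ge C : pre_le C (saturation C).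
Proof.
have [PC EC _ _] := Cl_ext C; split=> // [x y /EC|x Cx].
  exact: EqBase.
apply: lub_ge; exists x; first by apply: EqRefl; apply: PC.
by rewrite /= asboolT.
Qed.

Section SaturationClosed.

Variable C : preAMRS.
Hypothesis eqv_pathsC : forall x y, eqv C x y -> paths C x /\ paths C y.

(** Restricting [eqv (Cl C)] to pairs of its own paths still gives a closed extension, so minimality
    applies. *)
Lemma Cl_eqv_paths x y : eqv (Cl C) x y -> paths (Cl C) x /\ paths (Cl C) y.
Proof.
have [PC EC pre fus] := Cl_ext C.
pose E x y := [/\ eqv (Cl C) x y, paths (Cl C) x & paths (Cl C) y].
suff CE : closed_ext C (paths (Cl C)) E by case/(_ _ _ CE).
split=> // [{}x {}y xy|i p a i' p' a' Px Py [Exy _ _]].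
  by have [/PC ? /PC ?] := eqv_pathsC xy; split=> //; apply: EC.
by have [] := fus _ _ _ _ _ _ Px Py Exy.
Qed.

Lemma saturation_eqv_paths x y : eqv (saturation C) x y ->
  paths (saturation C) x /\ paths (saturation C) y.
Proof.
elim=> {x y} [x y /Cl_eqv_paths //|x y //|x y _ []|x y z _ [? ?] _ [? ?]] //.
Qed.

Let step x y := forall a, paths (saturation C) (extend x a) ->
  paths (saturation C) (extend y a) /\
  eqv (saturation C) (extend x a) (extend y a).

(** Fusion has to survive the generated equivalence. Both directions are carried through the
    induction, so that the symmetric case merely swaps them. *)
Let saturation_extend x y : eqv (saturation C) x y -> step x y /\ step y x.
Proof.
have [PC EC pre fus] := Cl_ext C.
elim=> {x y} [x y xy|x Px|x y _ []|x y z _ [xy yx] _ [yz zy]] //.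
- have [Px Py] := Cl_eqv_paths xy.
  case: x y xy Px Py => [i p] [j q] xy; rewrite -{1}[p]cats0 -{1}[q]cats0.
  move=> Px Py; split=> a Pa.
    by have [_ ? _ ?] := fus _ _ _ _ _ _ Pa Py xy; split=> //;
      apply/EqSym/EqBase.
  by have [? _ ? _] := fus _ _ _ _ _ _ Px Pa xy; split=> //; apply/EqSym/EqBase.
- by split=> a ?; split=> //; apply: EqRefl.
- split=> a.
    by case/xy => [/yz [? yza] xya]; split=> //; apply: EqTrans xya yza.
  by case/zy => [/yx [? yxa] zya]; split=> //; apply: EqTrans zya yxa.
Qed.

Lemma saturation_closed : closed (saturation C).
Proof.
have [PC EC pre fus] := Cl_ext C.
split=> //.
- exact: saturation_eqv_paths.
- move=> i p a i' p' a' Px Px' /saturation_extend [+ +].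
  by move=> /(_ _ Px) [? ?] /(_ _ Px') [? ?]; split=> //; apply: EqSym.
- by move=> x ?; apply: EqRefl.
- by move=> x y ?; apply: EqSym.
- by move=> x y z xy yz; apply: EqTrans xy yz.
- move=> x y xy /=; congr lub; congr (image _ _).
  by apply/seteqP; split=> z /= zx;
    [apply: EqTrans zx xy | apply: EqTrans zx (EqSym xy)].
Qed.

(* Fusion only adds continuations that some equivalent path already has, so the
   closure creates no new class. *)
Lemma saturation_class x : prefix_closed (paths C) ->
  paths (saturation C) x -> exists2 y, paths C y & eqv (saturation C) y x.
Proof.
move=> preC; have [PC EC pre fus] := Cl_ext C.
have cS := saturation_closed.
pose old y := exists2 z, paths C z & eqv (saturation C) z y.
(* An old representative is demanded for every prefix, not only for the path itself, because fusion
   splits paths at arbitrary points. *)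
pose P y := paths (Cl C) y /\ forall p a, y.2 = p ++ a -> old (y.1, p).
suff CP : closed_ext C P (eqv (Cl C)).
  by move=> /(_ _ _ CP) [_]; case: x => i p /(_ p [::]); rewrite cats0; apply.
split=> //.
- move=> [i q] /= Cq; split=> [|p a /= qE]; first exact: PC.
  have Cp : paths C (i, p) by apply: (preC i p a); rewrite -qE.
  by exists (i, p); last by apply: EqRefl; apply: PC.
- move=> i p a [/= Pq oldq]; split=> [|p' a' /= pE]; first exact: pre Pq.
  by apply: (oldq p' (a' ++ a)); rewrite pE catA.
have old_fusion i p a i' p' a' : P (i, p ++ a) -> P (i', p' ++ a') ->
    eqv (saturation C) (i, p) (i', p') -> paths (Cl C) (i', p' ++ a) ->
    P (i', p' ++ a).
  move=> [/= Pq oldq] [/= Pq' oldq'] xx' Pn; split=> // r b /= rE.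
  (* A prefix [r] of [p' ++ a] either lies inside [p'], hence is a prefix of [p' ++ a'], or is
     [p' ++ c] with [c] a prefix of [a], and then it is equivalent to the prefix [p ++ c] of
     [p ++ a]. *)
  have [le|/ltnW le] := leqP (size r) (size p').
    have rE' : r = take (size r) p'.
      by rewrite -(takel_cat a le) rE take_size_cat.
    apply: (oldq' r (drop (size r) p' ++ a')).
    by rewrite catA {1}rE' cat_take_drop.
  have rE' : r = p' ++ drop (size p') r.
    have := congr1 (take (size p')) rE;
      rewrite take_size_cat// takel_cat// => {1}->.
    by rewrite cat_take_drop.
  have aE : a = drop (size p') r ++ b.
    by move: rE; rewrite {1}rE' -catA => /eqP;
      rewrite eqseq_cat// => /andP[_ /eqP].
  have [|z Cz zE] := oldq (p ++ drop (size p') r) b; first by rewrite aE catA.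
  exists z => //; apply: EqTrans zE _.
  rewrite (_ : (i', r) = (i', p' ++ drop (size p') r)); last by rewrite -rE'.
  have [|_ //] := fusion_extend cS (a := drop (size p') r) xx'.
  by apply: (pre i _ b); rewrite /extend /= -catA -aE.
move=> {}i {}p a i' p' a' Px Px' xx'.
have [? ? ? ?] := fus _ _ _ _ _ _ Px.1 Px'.1 xx'.
split=> //.
  by apply: old_fusion Px' Px _ _ => //; apply/EqSym/EqBase.
by apply: old_fusion Px Px' _ _ => //; apply/EqBase.
Qed.

End SaturationClosed.

(** * Unification as a least upper bound *)

Section Unification.

Variables (A B : preAMRS) (J : pred nat) (f : nat -> nat).
Hypotheses (cA : closed A) (cB : closed B).

Let U := unif_along A J f B.
Let C := unif_base A J f B.

Let C_eqv_paths x y : eqv C x y -> paths C x /\ paths C y.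
Proof.
case=> [/(closed_eqv_paths cA) []|[jx jy /(closed_eqv_paths cB) []]].
  by split; left.
by split; right.
Qed.

Lemma unif_along_closed : closed U.
Proof. exact: saturation_closed C_eqv_paths. Qed.

Lemma unif_along_gel : pre_le A U.
Proof.
apply: (pre_le_trans _ (saturation_ge C)); split=> // [x|x y|x] /=.
- by left.
- by left.
- by case: ifP => // _ Ax; apply: lub_ge; left.
Qed.

Lemma unif_along_ger : le_along J f B U.
Proof.
apply: (le_along_trans _ (saturation_ge C)); split=> [x jx|x y jx jy|x jx] /=.
- by right.
- by right.
- by rewrite jx => Bx; apply: lub_ge; right.
Qed.

Lemma unif_along_le V :
  closed V -> pre_le A V -> le_along J f B V -> pre_le U V.
Proof.
move=> cV [l PA EA TA] [PB EB TB]; apply: saturation_le => //; split=> //.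
- by move=> x [/PA//|[jx /(PB _ jx)]].
- by move=> x y [/EA//|[jx jy /(EB _ _ jx jy)]].
- move=> x /= Ux; case: ifP => jx.
    by apply: lub_le => s [[? ->]|[? ->]]; [apply: TA | apply: TB].
  by case: Ux => [/TA//|[]]; rewrite jx.
Qed.

End Unification.

Lemma unif_along_AMRS A B J f : is_AMRS A -> is_AMRS B ->
  {subset J <= Ind (len A)} -> is_AMRS (unif_along A J f B).
Proof.
move=> aA aB JA; have cA := AMRS_closed aA; have cB := AMRS_closed aB.
set U := unif_along A J f B.
have cU : closed U by apply: unif_along_closed.
have [_ PA EA _] : pre_le A U by apply: unif_along_gel.
have [PB EB _] : le_along J f B U by apply: unif_along_ger.
have hit x : paths U x ->
    exists2 y, paths (unif_base A J f B) y & eqv U y x.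
  apply: saturation_class.
    move=> y z [/(closed_eqv_paths cA) []|[jx jy /(closed_eqv_paths cB) []]].
      by split; left.
    by split; right.
  move=> i p a [/(closed_prefix cA)|[/= ji /(closed_prefix cB)]]; first by left.
  by right.
split; [split|..].
(* All paths with an index of [A], under the total relation, form a closed extension, which bounds
   the indices that the closure can reach. *)
- move=> x /(_ [set y | y.1 \in Ind (len A)] (fun _ _ => True)); apply;
    split=> //.
  by move=> y [/(paths_ind (AMRS_pre aA))//|[/JA]].
- by move=> i /(paths_root (AMRS_pre aA)) [p Ap]; exists p; apply: PA.
- exact: closed_eqv_paths cU.
- exact: closed_prefix cU.
- exact: closed_fusion cU.
- exact: closed_refl cU.
- exact: closed_sym cU.
- exact: closed_trans cU.
- pose to x : ipath := (f x.1, x.2).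
  (* [gA] and [gB] carry classes of [A] and [B] over to [U]. By [hit], their values include every
     class of [U]. *)
  pose gA (S : set ipath) := [set y | exists2 z, S z & eqv U z y].
  pose gB (S : set ipath) :=
    [set y | exists z, [/\ z.1 \in J, S (to z) & eqv U z y]].
  pose classes (D : preAMRS) := [set [set y | eqv D x y] | x in paths D].
  have fin : finite_set (gA @` classes A `|` gB @` classes B).
    rewrite finite_setU; split; apply: finite_image.
      exact: AMRS_finite aA.
    exact: AMRS_finite aB.
  apply: sub_finite_set fin => _ [x /hit [y Cy yx] <-].
  case: Cy => [Ay|[jy By]]; [left|right].
    exists [set z | eqv A y z]; first by exists y.
    apply/seteqP; split=> z /=.
      case=> t /EA yt tz.
      exact: (closed_trans cU (closed_trans cU (closed_sym cU yx) yt) tz).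
    by move=> xz; exists y;
      [apply: (closed_refl cA)|apply: (closed_trans cU yx xz)].
  exists [set z | eqv B (to y) z]; first by exists (to y).
  apply/seteqP; split=> z /=.
    case=> t [jt /(EB _ _ jy jt) yt tz].
    exact: (closed_trans cU (closed_trans cU (closed_sym cU yx) yt) tz).
  move=> xz; exists y; split=> //; first exact: (closed_refl cB).
  exact: (closed_trans cU yx xz).
- exact: closed_typ cU.
Qed.

(** * Gluing a structure to a rule instance along the element they share *)

Section Replacement.

Variables (A R : preAMRS) (j : nat).
Hypotheses (cA : closed A) (cR : closed R).
Let m := len R.
Hypothesis shared_paths : forall p, paths R (m, p) <-> paths A (j, p).
Hypothesis shared_eqv :
  forall p q, eqv R (m, p) (m, q) <-> eqv A (j, p) (j, q).
Hypothesis shared_typ : forall p, paths A (j, p) -> typ R (m, p) = typ A (j, p).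

(* The element of [A] or of [R] that [repl A R j] has at position [t]. *)
Definition origin (t : nat) : nat + nat :=
  if t < j then inl t
  else if t < j + m - 1 then inr (t + 1 - j) else inl (t + 2 - m).

Definition glue_paths (k : nat + nat) p : Prop :=
  match k with inl i => paths A (i, p) | inr i => paths R (i, p) end.

Definition glue_typ (k : nat + nat) p : TYPES :=
  match k with inl i => typ A (i, p) | inr i => typ R (i, p) end.

Definition glue_cross i p i' q : Prop :=
  exists2 r, eqv A (i, p) (j, r) & eqv R (m, r) (i', q).

Definition glue_eqv (k : nat + nat) p (l : nat + nat) q : Prop :=
  match k, l with
  | inl i, inl i' => eqv A (i, p) (i', q)
  | inr i, inr i' => eqv R (i, p) (i', q)
  | inl i, inr i' => glue_cross i p i' q
  | inr i, inl i' => glue_cross i' q i p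
  end.

(** The amalgam of [A] and [R] over the shared element, restricted to the positions that survive
    replacement. Both copies of that element are dropped, whence the [- 2]. *)
Definition glue : preAMRS :=
  PreAMRS (len A + len R - 2)
    [set x | glue_paths (origin x.1) x.2]
    (fun x => glue_typ (origin x.1) x.2)
    (fun x y => glue_eqv (origin x.1) x.2 (origin y.1) y.2).

Lemma glue_crossA i p i' q i0 p0 :
  eqv A (i0, p0) (i, p) -> glue_cross i p i' q -> glue_cross i0 p0 i' q.
Proof.
by move=> E [r Ar Rr]; exists r => //; apply: (closed_trans cA E Ar).
Qed.

Lemma glue_crossR i p i' q i0 p0 :
  eqv R (i', q) (i0, p0) -> glue_cross i p i' q -> glue_cross i p i0 p0.
Proof.
by move=> E [r Ar Rr]; exists r => //; apply: (closed_trans cR Rr E).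
Qed.

Lemma glue_sym k p l q : glue_eqv k p l q -> glue_eqv l q k p.
Proof.
by case: k l => [i|i] [i'|i'] //=; apply: closed_sym.
Qed.

(* Two consecutive cross pairs meet in the shared element, where [A] and [R]
   agree. *)
Lemma glue_trans k p l q n r :
  glue_eqv k p l q -> glue_eqv l q n r -> glue_eqv k p n r.
Proof.
case: k l n => [i|i] [i'|i'] [i''|i''] /=.
- exact: (closed_trans cA).
- exact: glue_crossA.
- case=> s As Rs [t At Rt]; apply: (closed_trans cA As).
  apply: (closed_trans cA _ (closed_sym cA At)); apply/shared_eqv.
  exact: (closed_trans cR Rs (closed_sym cR Rt)).
- by move=> + E; apply: glue_crossR.
- by move=> + E; apply: glue_crossA; apply: (closed_sym cA E).
- case=> s As Rs [t At Rt]; apply: (closed_trans cR (closed_sym cR Rs)).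
  apply: (closed_trans cR _ Rt); apply/shared_eqv.
  exact: (closed_trans cA (closed_sym cA As) At).
- by move=> E; apply: glue_crossR; apply: (closed_sym cR E).
- exact: (closed_trans cR).
Qed.

(** A continuation crosses between [A] and [R] by passing through the shared element, which has the
    same paths on both sides. *)
Lemma glue_extend k p l q a : glue_eqv k p l q -> glue_paths k (p ++ a) ->
  glue_paths l (q ++ a) /\ glue_eqv k (p ++ a) l (q ++ a).
Proof.
case: k l => [i|i] [i'|i'] /=.
- exact: fusion_extend.
- case=> r Ar Rr Pa; have [Pj Ej] := fusion_extend cA Ar Pa.
  have [|? ?] := fusion_extend cR (a := a) Rr; first exact/shared_paths.
  by split=> //; exists (r ++ a).
- case=> r Ar Rr Pa; have [Pm Em] := fusion_extend cR (closed_sym cR Rr) Pa.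
  have [|? ?] := fusion_extend cA (a := a) (closed_sym cA Ar).
    exact/shared_paths.
  by split=> //; exists (r ++ a); apply: closed_sym.
- exact: fusion_extend.
Qed.

Lemma glue_cross_paths i p i' q :
  glue_cross i p i' q -> paths A (i, p) /\ paths R (i', q).
Proof. by case=> r /(closed_eqv_paths cA) [? _] /(closed_eqv_paths cR) []. Qed.

Lemma glue_cross_typ i p i' q :
  glue_cross i p i' q -> typ A (i, p) = typ R (i', q).
Proof.
case=> r Ar Rr; have [_ Aj] := closed_eqv_paths cA Ar.
by rewrite (closed_typ cA Ar) -shared_typ// (closed_typ cR Rr).
Qed.

Lemma glue_closed : closed glue.
Proof.
split.
- move=> [t p] [u q] /=; case: (origin t) (origin u) => [i|i] [i'|i'] /=.
  + exact: closed_eqv_paths.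
  + exact: glue_cross_paths.
  + by case/glue_cross_paths.
  + exact: closed_eqv_paths.
- move=> t p a /=; case: (origin t) => i /=; first exact: (closed_prefix cA).
  exact: (closed_prefix cR).
- move=> t p a u q b /= Pt Pu E.
  have [? ?] := glue_extend E Pt; have [? ?] := glue_extend (glue_sym E) Pu.
  by split=> //; apply: glue_sym.
- move=> [t p] /=; case: (origin t) => i /=; exact: closed_refl.
- by move=> x y; apply: glue_sym.
- by move=> x y z; apply: glue_trans.
- move=> [t p] [u q] /=; case: (origin t) (origin u) => [i|i] [i'|i'] /=.
  + exact: closed_typ.
  + exact: glue_cross_typ.
  + by move/glue_cross_typ.
  + exact: closed_typ.
Qed.

Hypotheses (j0 : 0 < j) (m0 : 0 < m).
Hypothesis indR : forall x, paths R x -> x.1 \in Ind m.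

Lemma origin_f i : i != j -> origin (repl_f R j i) = inl i.
Proof.
move=> /eqP ij; rewrite /origin /repl_f -/m; case: (ltnP i j) => [-> //|ji].
rewrite !ifF; first by congr inl; lia.
all: by lia.
Qed.

Lemma origin_g i : 0 < i < m -> origin (repl_g j i) = inr i.
Proof.
move=> im; rewrite /origin /repl_g ifF; last by lia.
by rewrite ifT; [congr inr|]; lia.
Qed.

(** Every path and pair of [repl_base] already occurs in [glue], with the same type; since [glue] is
    closed, the closure stays below it. *)
Lemma repl_le_glue : pre_le (repl A R j) glue.
Proof.
apply: saturation_le; first exact: glue_closed.
have origin_R i p : i < m -> paths R (i, p) -> origin (repl_g j i) = inr i.
  by move=> im /indR; rewrite inE /= => ?; apply: origin_g; lia.
split=> //.
- by move=> _ [i p ij Ap|i p im Rp] /=; rewrite ?origin_f ?(origin_R _ p).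
- move=> _ _ [i p i' q ij ij' E|i p i' q im im' E|i p i' q r ij im E E'|
              i p i' q r ij im E E'] /=.
  + by rewrite !origin_f.
  + have [? ?] := closed_eqv_paths cR E.
    by rewrite (origin_R _ p)// (origin_R _ q).
  + have [_ ?] := closed_eqv_paths cR E'.
    by rewrite origin_f// (origin_R _ q)//; exists r.
  + have [_ ?] := closed_eqv_paths cR E'.
    by rewrite origin_f// (origin_R _ q)//; exists r.
- move=> [t p] _ /=; rewrite /repl_typ /glue_typ /origin /= -/m.
  by case: ifP => // _; case: ifP.
Qed.

(** At a position coming from [A], [glue] is the original element of [A], so replacement adds no
    information there. The next lemma is the counterpart for [R]. *)
Lemma le_at_repl_f X i :
  i != j -> le_at X (repl A R j) (repl_f R j i) -> le_at X A i.
Proof.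
move=> ij /le_along_trans/(_ repl_le_glue)/le_atP [].
by rewrite /= origin_f// => ? ? ?; apply/le_atP.
Qed.

Lemma le_at_repl_g X i :
  0 < i < m -> le_at X (repl A R j) (repl_g j i) -> le_at X R i.
Proof.
move=> im /le_along_trans/(_ repl_le_glue)/le_atP [].
by rewrite /= origin_g// => ? ? ?; apply/le_atP.
Qed.

End Replacement.

Lemma le_at_elt A B i j : le_at (elt A j) B i ->
  [/\ forall p, paths A (j, p) -> paths B (i, p),
      forall p q, eqv A (j, p) (j, q) -> eqv B (i, p) (i, q) &
      forall p, paths A (j, p) -> (typ A (j, p) <= typ B (i, p))%O].
Proof.
move=> /le_atP [] /=; rewrite subSnn add1n subn1 /= => P E T.
by split=> [p ?|p q ?|p ?]; [apply: P|apply: E|apply: T]; split.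
Qed.

Lemma elt_AMRS A j : is_AMRS A -> j \in Ind (len A) -> is_AMRS (elt A j).
Proof. by move=> aA; rewrite inE => /andP[]; apply: sub_AMRS. Qed.

(* The hypotheses say that the element rewritten in a derivation step and the
   head of the rule unify without changing either. *)
Lemma head_element A R j : is_AMRS A -> is_AMRS R ->
  j \in Ind (len A) -> 0 < len R ->
  same A (unif1 A j (elt R (len R))) -> same R (unif1 R (len R) (elt A j)) ->
  [/\ forall p, paths R (len R, p) <-> paths A (j, p),
      forall p q, eqv R (len R, p) (len R, q) <-> eqv A (j, p) (j, q) &
      forall p, paths A (j, p) -> typ R (len R, p) = typ A (j, p)].
Proof.
move=> aA aR jA m0 /same_sym/same_pre_le sA /same_sym/same_pre_le sR.
have mR : len R \in Ind (len R) by rewrite inE m0 /=.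
have cA := AMRS_closed aA; have cR := AMRS_closed aR.
have cAj := AMRS_closed (elt_AMRS aA jA);
  have cRm := AMRS_closed (elt_AMRS aR mR).
have /le_at_elt [PA EA TA] : le_at (elt R (len R)) A j.
  by apply: le_along_trans sA; apply: unif_along_ger.
have /le_at_elt [PR ER TR] : le_at (elt A j) R (len R).
  by apply: le_along_trans sR; apply: unif_along_ger.
split=> [p|p q|p Ap]; [by split; auto|by split; auto|].
by apply: le_anti; rewrite TA ?TR //; apply: PR.
Qed.

End Closure.

Lemma consistent_sub A j k : consistent A -> consistent (sub A j k).
Proof. by move=> cA x [_ /cA]. Qed.

Lemma lambda_AMRS : is_AMRS (lambda : preAMRS).
Proof.
split=> //; first by split=> //= i; rewrite inE; lia.
by rewrite image_set0.
Qed.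

Lemma lambda_consistent : consistent (lambda : preAMRS).
Proof. by []. Qed.

End Structures.

(** * Abstractions of multi-rooted graphs are AMRSs *)

Section Abstraction.

Context {d : Order.disp_t} {FEATS : finType} {TYPES : finTBPOrderType d}
  {NODES : choiceType} (theta : NODES -> TYPES) (s : mrs NODES FEATS).

Lemma walk_cat dl (q : NODES) (p a : seq FEATS) :
  walk dl q (p ++ a) = obind (fun q' => walk dl q' a) (walk dl q p).
Proof. by elim: p q => //= f p IH q; case: (dl q f). Qed.

Lemma node_at_cat i p a :
  node_at s (i, p ++ a) = obind (fun q => walk (delta s) q a)
                               (node_at s (i, p)).
Proof.
case: i => //= i; rewrite /node_at /=; case: (onth (Defs.roots s) i) => //= q.
exact: walk_cat.
Qed.

Lemma node_at_nodes x q : node_at s x = Some q -> q \in nodes s.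
Proof.
case: x => [[|i] p] //; rewrite /node_at /=.
case E: (onth (Defs.roots s) i) => [r|] //=.
have {E} : r \in nodes s by apply: roots_nodes; apply/onthP; exists i.
elim: p r => [|f p IH] r rs /=; first by case=> <-.
by case D: (delta s r f) => [r'|] //=; have [_ /IH] := delta_nodes D; apply.
Qed.

Lemma Abs_AMRS : is_AMRS (Abs theta s).
Proof.
split; first split.
- move=> [[|i] p] //; rewrite inE /= /node_at /=.
  by rewrite -onthTE; case: (onth (Defs.roots s) i).
- move=> [|i]; rewrite inE //= => im; exists [::].
  by rewrite /node_at /=; move: im; rewrite -onthTE; case: onth.
- by move=> x y [q /= -> ->].
- by move=> i p a /=; rewrite node_at_cat; case: node_at.
- move=> i p a i' p' a' /= + + [q ip ip'].
  rewrite !node_at_cat ip ip' /=.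
  case E: (walk _ q a) => [r|] //; case E': (walk _ q a') => [r'|] // _ _.
  by split; rewrite /= ?node_at_cat ?ip ?ip' /= ?E ?E' //; [exists r'|exists r].
- by move=> x /=; case E: (node_at s x) => [q|] // _; exists q.
- by move=> x y [q xq yq]; exists q.
- by move=> x y z [q xq yq] [r yr zr]; exists q => //; rewrite zr -yr.
(* The classes are fibres of [node_at] over the finitely many nodes. *)
- pose g q := [set y | node_at s y = Some q].
  apply: sub_finite_set (finite_image g (finite_fset (nodes s)))
    => _ [x /= Px <-].
  case E: (node_at s x) Px => [q|] // _; exists q; first exact: node_at_nodes E.
  by apply/seteqP; split=> y /=; [exists q|case=> r [->]].
- by move=> x y [q /= -> ->].
Qed.

Lemma Abs_consistent : mrs_consistent theta s -> consistent (Abs theta s).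
Proof.
by move=> cs x /=; case E: (node_at s x) => [q|] // _;
  apply/cs/(node_at_nodes E).
Qed.

End Abstraction.

(** * The chart, and coverage of the input by recognized elements *)

Section Grammars.

Context {d : Order.disp_t} {FEATS : finType} {TYPES : finTBPOrderType d}
  {NODES : choiceType} {theta : NODES -> TYPES} {WORDS : Type}
  {L : lexicon (FEATS := FEATS) theta (WORDS := WORDS)} (G : grammar L).

Local Notation Abs := (Abs theta).
Local Notation item := (item (FEATS := FEATS) (TYPES := TYPES)).

Implicit Types (w : seq WORDS) (I : set item) (x : item)
  (A B R : preAMRS FEATS TYPES).

Lemma PT_seq_le_at w A : PT_seq (L := L) w A -> len A = size w /\
  forall i u, onth w i = Some u -> exists2 F, L u F & le_at (Abs F) A i.+1.
Proof.
elim: w A => [A ->|v w IH _ [F [B [LF /IH [lB leB] ->]]]] /=.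
  by split=> // i u; rewrite onth0n.
have lF := tfs_root F.
split=> [|[|i] u /=]; first by rewrite lF lB.
  case=> <-; exists F => //; apply/le_atP.
  by rewrite /concat /= lF.
case/leB=> F' LF' /le_atP[P E T]; exists F' => //; apply/le_atP.
by split=> [p /P|p q /E|p /T]; rewrite /= lF /= subn1.
Qed.

Lemma T_step_mono w I I' : I `<=` I' -> T_step G w I `<=` T_step G w I'.
Proof.
move=> II' x [|[|]]; last by right; right.
  case=> rho [k [xa [xb [r m1 km [[Ia sa la] [[Ib sb lb] h]]]]]].
  by left; exists rho, k, xa, xb; do !split=> //; apply: II'.
case=> rho [xa [r m1 [Ia sa la] cC h]].
by right; left; exists rho, xa; do !split=> //; apply: II'.
Qed.

Lemma computation_mono w l l' :
  l <= l' -> computation G w l `<=` computation G w l'.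
Proof.
move=> /subnK <-; elim: (l' - l) => // n IH x /IH.
have mono k : computation G w k `<=` computation G w k.+1.
  by elim: k => [y //|k IHk]; apply: T_step_mono.
exact: mono.
Qed.

Definition chart w : set item := [set x | exists l, computation G w l x].

(** Premises found at different stages are all present at the latest of these stages, as the stages
    increase. *)
Lemma chart_closed w : T_step G w (chart w) `<=` chart w.
Proof.
move=> x [|[|Tx]]; last by exists 1; right; right.
  case=> rho [k [xa [xb [r m1 km [[[la Ia] sa la'] [[[lb Ib] sb lb'] h]]]]]].
  exists (maxn la lb).+1; left; exists rho, k, xa, xb; do !split=> //.
    exact: computation_mono (leq_maxl _ _) _ Ia.
  exact: computation_mono (leq_maxr _ _) _ Ib.
case=> rho [xa [r m1 [[la Ia] sa la'] cC h]].
by exists la.+1; right; left; exists rho, xa.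
Qed.

(** Subsumption rather than equality: items are computed from the rules themselves, derivations use
    more specific instances. *)
Definition recognized w A i a b : Prop :=
  exists x,
    [/\ chart w x, item_from x = a, item_to x = b, item_status x = Comp &
        len (item_str x) = 1 /\ le_at (item_str x) A i].

Lemma recognized_le w A i B j a b : (forall X, le_at X A i -> le_at X B j) ->
  recognized w A i a b -> recognized w B j a b.
Proof. by move=> le [x [? ? ? ? [? /le ?]]]; exists x. Qed.

(** The invariant of the backward induction. [pos] lists the boundaries of consecutive spans, some
    of which may be empty. *)
Definition covered w A : Prop :=
  exists pos : nat -> nat, [/\ pos 0 = 0, pos (len A) = size w &
    forall i, i \in Ind (len A) -> recognized w A i (pos i.-1) (pos i)].

Lemma PT_covered w A : PT (L := L) w 1 (size w) A -> covered w A.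
Proof.
rewrite /PT subnn drop0 take_size => /PT_seq_le_at [lA leA].
(* Element [i] of a preterminal string spans exactly the [i]-th word. *)
exists id; split=> // [] [|i]; rewrite inE lA //= => iw.
have [u wu] : exists u, onth w i = Some u.
  by move: iw; rewrite -onthTE; case: onth => // u; exists u.
have [F LF leF] := leA i u wu.
pose S := Amrs (Abs_AMRS theta F) (Abs_consistent (Cat_consistent LF)).
exists (Item S Comp (leqnSn i)); split=> //; last by rewrite /= tfs_root.
apply: chart_closed; do 4!right; exists i.+1, u, F.
by rewrite subn1; split=> //; split=> //; apply: same_refl.
Qed.

(** * Recognition of the head of a rule, and a derivation step read backwards *)

Section Completeness.

Hypothesis lubs : forall S : set TYPES, has_ubound S -> supremums S !=set0.

Section Rule.

Variables (w : seq WORDS) (rho : mrs NODES FEATS) (R : preAMRS FEATS TYPES).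
Variable pos : nat -> nat.
Hypotheses (Grho : rules G rho) (rhoR : pre_le (Abs rho) R).
Hypotheses (aR : is_AMRS R) (consR : consistent R).
Hypothesis pos0 : pos 0 <= size w.
Hypothesis body :
  forall i, 0 < i < len R -> recognized w R i (pos i.-1) (pos i).

Let cR := AMRS_closed aR.
Let len_rho : len (Abs rho) = len R. Proof. by case: rhoR. Qed.

(** Induction on the position of the dot: [T_empty] starts with [lambda], and [T_combine] consumes
    the item for element [k.+1]. Both unifications lie below [R], an upper bound of all their
    operands, and so do not fail. *)
Lemma active_items k : k < len R -> exists x,
  [/\ chart w x, item_from x = pos 0, item_to x = pos k, item_status x = Act &
      len (item_str x) = k /\ le_along (Ind k) id (item_str x) R].
Proof.
elim: k => [_|k IH km].
  exists (Item (Amrs lambda_AMRS lambda_consistent) Act (leqnn (pos 0))).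
  split=> //; apply: chart_closed; right; right; left.
  by exists (pos 0) => //; split=> //; apply: same_refl.
have [xa [Ia fa ta sa [la lea]]] := IH (ltnW km).
have [|xb [Ib fb tb sb [lb leb]]] := body (i := k.+1); first by rewrite km.
pose B := unif (Abs rho) (Ind k) (item_str xa).
pose C := unif1 B k.+1 (item_str xb).
have aB : is_AMRS B.
  apply: unif_along_AMRS (Abs_AMRS theta rho) (amrsP _) _ => // i.
  by rewrite len_rho !inE; lia.
have aC : is_AMRS C.
  apply: unif_along_AMRS aB (amrsP _) _ => // i.
  by rewrite [len B]len_rho !inE; lia.
have BR : pre_le B R by apply: unif_along_le.
have CR : pre_le C R by apply: unif_along_le.
have consC := pre_le_consistent CR consR.
have aS : is_AMRS (sub C 1 k.+1).
  by apply: sub_AMRS => //; rewrite [len C]len_rho ltnW.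
have ab : item_from xa <= item_to xb.
  by apply: leq_trans (item_le xa) _; rewrite ta -fb item_le.
exists (Item (Amrs aS (consistent_sub consC)) Act ab).
split=> //=; last first.
  split; first by lia.
  apply: pre_le_along (sub_pre_le _ _ CR) _; exact: sub1_le_along.
apply: chart_closed; left; exists rho, k, xa, xb; split=> //=.
- by move: len_rho; rewrite /=; lia.
- by move: len_rho; rewrite /=; lia.
do 2!(split; first by []).
split=> //; first by rewrite ta fb.
exact: pre_le_consistent BR consR.
Qed.

(** A rule of length 1 enters the chart by [T_epsilon]. Otherwise [T_complete] applies to the active
    item that spans the whole body. *)
Lemma head_recognized :
  0 < len R -> recognized w R (len R) (pos 0) (pos (len R).-1).
Proof.
move=> m0; have [m1|m1] := leqP (len R) 1.
  have mE : len R = 1 by lia.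
  have consA := Abs_consistent (rules_consistent Grho).
  exists (Item (Amrs (Abs_AMRS theta rho) consA) Comp (leqnn (pos 0))).
  rewrite mE /=; split=> //=; last first.
    split; first by rewrite -mE -len_rho.
    exact: pre_le_at.
  apply: chart_closed; do 3!right; left; exists (pos 0), rho; split=> //.
  by rewrite -mE -len_rho.
rewrite -len_rho -subn1.
have [|xa [Ia fa ta sa [la lea]]] := active_items (k := len (Abs rho) - 1).
  by rewrite len_rho; lia.
pose C := unif (Abs rho) (Ind (len (Abs rho) - 1)) (item_str xa).
have aC : is_AMRS C.
  apply: unif_along_AMRS (Abs_AMRS theta rho) (amrsP _) _ => // i.
  by rewrite !inE; lia.
have CR : pre_le C R by apply: unif_along_le.
have consC := pre_le_consistent CR consR.
have aS : is_AMRS (elt C (len (Abs rho))).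
  by apply: elt_AMRS; rewrite // [len C]len_rho len_rho inE m0 /=.
exists (Item (Amrs aS (consistent_sub consC)) Comp (item_le xa)).
split=> //; last first.
  split; first by rewrite /= subSnn.
  apply: pre_le_along (sub_pre_le _ _ CR) _; exact: elt_le_at.
apply: chart_closed; right; left; exists rho, xa; split=> //.
by rewrite len_rho.
Qed.

End Rule.

(** This provides the bound on positions in [T_empty] and [T_epsilon]. Since [item_le] makes the
    boundaries increase up to [size w], the induction is on the distance to the last index. *)
Lemma covered_pos_le w A (pos : nat -> nat) : pos (len A) = size w ->
  (forall i, i \in Ind (len A) -> recognized w A i (pos i.-1) (pos i)) ->
  forall i, i <= len A -> pos i <= size w.
Proof.
move=> <- rec i /subnKC; move: (len A - i) => n; elim: n i => [|n IH] i iA.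
  by rewrite -iA addn0.
have [|x [_ fx tx _ _]] := rec i.+1; first by rewrite inE; lia.
by apply: leq_trans (IH i.+1 _); [rewrite -tx -[i]/i.+1.-1 -fx item_le|lia].
Qed.

Lemma sderiv_covered w (A B : amrs FEATS TYPES) :
  sderiv G A B -> covered w B -> covered w A.
Proof.
case=> rho [R [j [Grho rhoR jA [sA sR _ sB]]]] [pos [pos0 posB rec]].
have m0 : 0 < len R by case: rhoR => <- *; apply: rules_nonempty Grho.
have aA := amrsP A; have aR := amrsP R.
have cA := AMRS_closed aA; have cR := AMRS_closed aR.
have [hP hE hT] := head_element lubs aA aR jA m0 sA sR.
have indR := paths_ind (AMRS_pre aR).
have lB : len B = len A + len R - 2 by case: sB.
have BE := same_pre_le sB.
move: (jA); rewrite inE => /andP[j0 jlA].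
(* Elements that are not rewritten keep their items, at their new positions in [B]. *)
have recA i : i != j -> i \in Ind (len A) ->
    recognized w A i (pos (repl_f R j i).-1) (pos (repl_f R j i)).
  move=> ij iA; apply: recognized_le (rec (repl_f R j i) _).
    move=> X /le_along_trans/(_ BE).
    exact: (le_at_repl_f lubs cA cR hP hE hT).
  by move: iA ij; rewrite lB !inE /repl_f; case: (ltnP i j); lia.
(* The body of [R] starts at position [j] of [B], so its boundaries are those of [B] shifted by
   [j.-1]. *)
have recR i : 0 < i < len R ->
    recognized w R i (pos (i.-1 + j.-1)) (pos (i + j.-1)).
  move=> im; have := rec (repl_g j i); rewrite lB inE /repl_g.
  rewrite (_ : (i + j - 1).-1 = i.-1 + j.-1); last by lia.
  rewrite (_ : i + j - 1 = i + j.-1); last by lia.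
  move=> H; apply: recognized_le (H _); last by lia.
  move=> X /le_along_trans/(_ BE).
  rewrite (_ : i + j.-1 = repl_g j i); last by rewrite /repl_g; lia.
  exact: (le_at_repl_g lubs cA cR hP hE hT).
have pos_le := covered_pos_le posB rec.
(* The head of [R] spans what its body spans, and the shared element turns a bound on the head into
   one on element [j] of [A]. *)
have recj : recognized w A j (pos j.-1) (pos (len R + j - 2)).
  have := head_recognized Grho rhoR aR (@amrs_consistent _ _ _ R)
    (pos := fun i => pos (i + j.-1)).
  rewrite add0n => /(_ w (pos_le _ _) recR m0).
  rewrite (_ : (len R).-1 + j.-1 = len R + j - 2); last by lia.
  move=> H; apply: recognized_le (H _); last by lia.
  move=> X /le_atP [P E T]; apply/le_atP; split=> [p /P|p q /E|p Xp].
  - by move/hP.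
  - by move/hE.
  - by rewrite -hT; [apply: T|apply/hP/P].
(* The boundaries inside the body are forgotten. If [R] has length 1, then element [j] gets the
   empty span at [pos j.-1]. *)
exists (fun i => if i < j then pos i else pos (i + len R - 2)); split.
- by rewrite j0.
- by rewrite ifF -?lB //; lia.
move=> i iA; have i0 : 0 < i by move: iA; rewrite inE; lia.
have [ij|ij|->] := ltngtP i j.
- have := recA i; rewrite /repl_f ij (ltn_eqF ij) => /(_ isT iA).
  by rewrite ifT //; lia.
- have := recA i; rewrite /repl_f ltnNge (ltnW ij) (gtn_eqF ij)
    => /(_ isT iA) /=.
  rewrite ifF; last by lia.
  by rewrite (_ : (i + len R - 2).-1 = i.-1 + len R - 2)//; lia.
- rewrite ifT; last by lia.
  by rewrite addnC.
Qed.

End Completeness.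
End Grammars.

Theorem theorem2p10p6 (d : Order.disp_t)
    (FEATS : finType) (TYPES : finTBPOrderType d)
    (NODES : choiceType) (theta : NODES -> TYPES)
    (WORDS : Type) (L : lexicon (FEATS := FEATS) theta (WORDS := WORDS))
    (G : grammar L) (w : seq WORDS) :
  0 < #|FEATS| ->
  (forall S : set TYPES, has_ubound S -> supremums S !=set0) ->
  (forall t : TYPES, infinite_set [set q | theta q = t]) ->
  language G w -> successful G w.
Proof.
move=> _ lubs _ [B PTB [A' [B' [lA' consU BB' derB']]]].
(* Coverage passes upwards from [B] to [B'], because items need only lie below the elements. *)
have covB' : covered G w B'.
  have [pos [p0 pB rec]] := PT_covered G PTB.
  case: (BB') => lB _ _ _; rewrite lB in pB rec.
  exists pos; split=> // i iB; apply: recognized_le (rec i iB) => X.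
  by move/le_along_trans; apply.
have : covered G w A'.
  elim: derB' covB' => {consU lA' BB'} [X Y|//|X Y Z _ XY _ YZ /YZ/XY //].
  exact: sderiv_covered.
rewrite /covered lA' /= tfs_root.
case=> pos [p0 p1 /(_ 1 isT) [x [[l Ix] fx tx sx [lx lex]]]].
exists l, x; split=> //; [by rewrite fx|by rewrite tx|split=> //].
(* [U] lies above the start structure and above [A'], hence above the item found. The unification of
   the item with the start structure is therefore below [U] and inherits its consistency. *)
set U := unif _ _ _ in consU.
have cS := AMRS_closed (Abs_AMRS theta (start G)).
have cA' := AMRS_closed (amrsP A').
have cU : closed U by apply: unif_along_closed.
have SU : pre_le (Abs theta (start G)) U by apply: unif_along_gel.
have A'U : pre_le A' U.
  by apply: (Ind_pre_le (B := U) (amrsP A') lA'); rewrite lA';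
    apply: unif_along_ger.
apply: pre_le_consistent consU; apply: unif_along_le => //.
  apply: pre_le_trans A'U; apply: (le_at_pre_le (amrsP _) lx _ lex).
  by rewrite lA' /= tfs_root.
by have := pre_le_Ind SU; rewrite /= tfs_root.
Qed.
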